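(* Let $W$ be a finite Coxeter group of simply-laced type with set of positive roots $\Phi^+$. Then for any $A \subseteq \Phi^+$, we have $\overline{A}^{\mathrm{pbr}} = \overline{A}$, where $\overline{A}^{\mathrm{pbr}}$ is the palindromic Bruhat preclosure of $A$ and $\overline{A}$ is the $2$-closure of $A$.
   Context: Let $(W,S)$ be a Coxeter system with Coxeter matrix $(m(s,t))_{s,t\in S}$ and length function $\ell$; it is simply-laced if $m(s,t)\in\{2,3\}$ for all $s\neq t$ in $S$. Let $\Phi$ be its root system (in the standard geometric representation), with positive roots $\Phi^+$ with respect to $S$. For $\alpha\in\Phi$, $s_\alpha\in W$ denotes the reflection in $\alpha$. For $A\subseteq\Phi^+$, the palindromic Bruhat preclosure $\overline{A}^{\mathrm{pbr}}$ is the set of those $\alpha \in \Phi^+$ for which there exist $\alpha_1, \ldots, \alpha_m \in A$ such that $s_\alpha = s_{\alpha_1} \cdots s_{\alpha_m}$, $0 < \ell(s_{\alpha_1}) < \ell(s_{\alpha_1} s_{\alpha_2}) < \cdots < \ell(s_{\alpha_1} \cdots s_{\alpha_m})$, and the sequence is palindromic: $\alpha_r=\alpha_{m+1-r}$ for $1\le r\le m$. A subset $A \subseteq \Phi^+$ is $2$-closed if for all $\alpha, \beta \in A$ and $a, b \in \mathbb{R}_{\ge 0}$ such that $a \alpha + b \beta \in \Phi^+$, we have $a \alpha + b \beta \in A$. The $2$-closure $\overline{A}$ of $A \subseteq \Phi^+$ is the intersection of all $2$-closed subsets of $\Phi^+$ containing $A$. *)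

(* Defs.v *)
From HB Require Import structures.
From mathcomp Require Import all_boot all_order all_algebra.
From mathcomp Require Import all_classical all_reals all_analysis.
From mathcomp Require Import ring lra.
Set Implicit Arguments.
Unset Strict Implicit.
Unset Printing Implicit Defensive.
Import Order.TTheory GRing.Theory Num.Theory.
Local Open Scope classical_set_scope.
Local Open Scope ring_scope.

(* The entry 0 encodes m(s,t) = oo; every other off-diagonal entry is >= 2. *)
Definition coxeter_matrix n (M : 'M[nat]_n) : Prop :=
  [/\ forall i, M i i = 1%N,
      forall i j, M i j = M j i
    & forall i j, i != j -> M i j <> 1%N].

(* The congruence on words in the simple reflections generated by
   (s_i s_j)^(M i j) ~ 1.  Since M i i = 1 these relations contain s_i^2 ~ 1, so
   the quotient of the free monoid by this congruence is the group
   < s_i | (s_i s_j)^(M i j) = 1 >.  When M i j = 0 (that is, oo) the word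
   below is empty and no relation is imposed. *)
Inductive cox_equiv n (M : 'M[nat]_n) : seq 'I_n -> seq 'I_n -> Prop :=
| cox_refl u : cox_equiv M u u
| cox_sym u v : cox_equiv M u v -> cox_equiv M v u
| cox_trans u v w : cox_equiv M u v -> cox_equiv M v w -> cox_equiv M u w
| cox_rel u v i j :
    cox_equiv M (u ++ flatten (nseq (M i j) [:: i; j]) ++ v) (u ++ v).

(* cs_gen and cs_presentation say that u |-> \prod_(i <- u) simple_refl i
   identifies the group with Coxeter presentation cox_mx with W. *)
Record coxeterSystem (W : groupType) := CoxeterSystem {
  rank : nat;
  cox_mx : 'M[nat]_rank;
  simple_refl : 'I_rank -> W;
  cs_matrix : coxeter_matrix cox_mx;
  cs_gen : forall w : W,
    exists u : seq 'I_rank, (\prod_(i <- u) simple_refl i)%g == w;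
  cs_presentation : forall u v : seq 'I_rank,
    (\prod_(i <- u) simple_refl i)%g = (\prod_(i <- v) simple_refl i)%g
    <-> cox_equiv cox_mx u v
}.

Arguments cox_mx {W} _.
Arguments simple_refl {W} _ _.
Arguments cs_gen {W} _ _.

Definition simply_laced (W : groupType) (cs : coxeterSystem W) : Prop :=
  forall i j, i != j -> cox_mx cs i j = 2%N \/ cox_mx cs i j = 3%N.

Section Length.
Variables (W : groupType) (cs : coxeterSystem W).

Definition word_prod (u : seq 'I_(rank cs)) : W :=
  (\prod_(i <- u) simple_refl cs i)%g.

Lemma ex_word_size (w : W) :
  exists k, `[< exists u, size u = k /\ word_prod u = w >].
Proof.
by have [u /eqP uw] := cs_gen cs w; exists (size u); apply/asboolP; exists u.
Qed.

Definition ell (w : W) : nat := ex_minn (ex_word_size w).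

End Length.

Section GeometricRepresentation.
Variables (R : realType) (W : groupType) (cs : coxeterSystem W).
Local Notation n := (rank cs).
Local Notation V := 'rV[R]_n.
Local Notation M := (cox_mx cs).

Definition simple_root (i : 'I_n) : V := delta_mx 0 i.

Definition gram : 'M[R]_n :=
  \matrix_(i, j) if M i j == 0%N then -1 else - cos (pi / (M i j)%:R).

Definition bform (u v : V) : R := (u *m gram *m v^T) 0 0.

(* For roots, which satisfy bform a a = 1, this is the orthogonal reflection. *)
Definition reflection (a v : V) : V := v - (2 * bform v a) *: a.

Lemma reflectionE a v :
  reflection a v = v + (- (2 * bform v a)) *: a.
Proof. by rewrite scaleNr. Qed.

Definition word_act (u : seq 'I_n) (v : V) : V :=
  foldr (fun i => reflection (simple_root i)) v u.

(* The choice of the word is irrelevant: see geom_act_word below. *)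
Definition geom_act (w : W) (v : V) : V := word_act (xchoose (cs_gen cs w)) v.

Lemma word_act_cat u1 u2 v : word_act (u1 ++ u2) v = word_act u1 (word_act u2 v).
Proof. by rewrite /word_act foldr_cat. Qed.

Lemma bformDl u v w : bform (u + v) w = bform u w + bform v w.
Proof. by rewrite /bform !mulmxDl mxE. Qed.

Lemma bformZl a u w : bform (a *: u) w = a * bform u w.
Proof. by rewrite /bform -!scalemxAl mxE. Qed.

Lemma bform_simple i j : bform (simple_root i) (simple_root j) = gram i j.
Proof.
by rewrite /bform /simple_root -rowE trmx_delta -colE !mxE.
Qed.

Lemma gram_diag i : gram i i = 1.
Proof.
by have [Mii _ _] := cs_matrix cs; rewrite mxE Mii /= divr1 cospi opprK.
Qed.

Lemma gramC i j : gram i j = gram j i.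
Proof. by have [_ MC _] := cs_matrix cs; rewrite !mxE MC. Qed.

Lemma reflection_simpleK i :
  involutive (reflection (simple_root i)).
Proof.
move=> v; rewrite !reflectionE bformDl bformZl bform_simple gram_diag.
rewrite -addrA -scalerDl [X in X *: _](_ : _ = 0); last by ring.
by rewrite scale0r addr0.
Qed.

Lemma iter_refl_pair i j (k : nat) v (t : R) :
  gram i j = - cos t -> let a := simple_root i in let b := simple_root j in
  let w := word_act (flatten (nseq k [:: i; j])) v in
  [/\ exists p q, w = v + p *: a + q *: b,
      sin t * bform w a =
        - sin (t * (2 * k%:R - 1)) * bform v a - sin (t * (2 * k%:R)) * bform v b
    & sin t * bform w b =
        sin (t * (2 * k%:R)) * bform v a + sin (t * (2 * k%:R + 1)) * bform v b].
Proof.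
move=> gij a b; elim: k => [|k] /=.
  split; first by exists 0, 0; rewrite !scale0r !addr0.
  - by rewrite !mulr0 sub0r mulrN1 sinN sin0 opprK; ring.
  - by rewrite !mulr0 add0r mulr1 sin0; ring.
set w := word_act _ v => -[[p [q wE]] wa wb].
have baa : bform a a = 1 by rewrite bform_simple gram_diag.
have bbb : bform b b = 1 by rewrite bform_simple gram_diag.
have bab : bform a b = - cos t by rewrite bform_simple.
have bba : bform b a = - cos t by rewrite bform_simple gramC.
rewrite -/a -/b.
set w' := reflection a (reflection b w).
have w'E : w' = w + (- (2 * (bform w a + 2 * bform w b * cos t))) *: a
                  + (- (2 * bform w b)) *: b.
  rewrite /w' !reflectionE bformDl bformZl bba addrAC.
  by congr (_ + _ *: _ + _); ring.
have w'a : bform w' a = - bform w a - 2 * cos t * bform w b.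
  by rewrite w'E !bformDl !bformZl baa bba; ring.
have w'b : bform w' b =
    2 * cos t * bform w a + (4 * cos t ^+ 2 - 1) * bform w b.
  by rewrite w'E !bformDl !bformZl bbb bab; ring.
have S0 : sin (t * (2 * k%:R - 1)) =
    sin (t * (2 * k%:R)) * cos t - cos (t * (2 * k%:R)) * sin t.
  by rewrite mulrBr mulr1 sinB.
have S1 : sin (t * (2 * k%:R + 1)) =
    sin (t * (2 * k%:R)) * cos t + cos (t * (2 * k%:R)) * sin t.
  by rewrite mulrDr mulr1 sinD.
have C1 : cos (t * (2 * k%:R + 1)) =
    cos (t * (2 * k%:R)) * cos t - sin (t * (2 * k%:R)) * sin t.
  by rewrite mulrDr mulr1 cosD.
have S2 : sin (t * (2 * k.+1%:R)) =
    sin (t * (2 * k%:R + 1)) * cos t + cos (t * (2 * k%:R + 1)) * sin t.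
  by rewrite -sinD; congr sin; rewrite -natr1; ring.
have C2 : cos (t * (2 * k.+1%:R)) =
    cos (t * (2 * k%:R + 1)) * cos t - sin (t * (2 * k%:R + 1)) * sin t.
  by rewrite -cosD; congr cos; rewrite -natr1; ring.
have S1' : sin (t * (2 * k.+1%:R - 1)) = sin (t * (2 * k%:R + 1)).
  by congr sin; rewrite -natr1; ring.
have S3 : sin (t * (2 * k.+1%:R + 1)) =
    sin (t * (2 * k.+1%:R)) * cos t + cos (t * (2 * k.+1%:R)) * sin t.
  by rewrite mulrDr mulr1 sinD.
have sc : sin t ^+ 2 = 1 - cos t ^+ 2 := sin2cos2 t.
split.
- exists (p - 2 * (bform w a + 2 * bform w b * cos t)), (q - 2 * bform w b).
  rewrite w'E {1}wE !scalerDl !scaleNr -!addrA.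
  by congr (_ + (_ + _)); rewrite addrCA.
- rewrite w'a; transitivity (- (sin t * bform w a)
    - 2 * cos t * (sin t * bform w b)); first by ring.
  rewrite wa wb S1' S2 C1 S1 S0.
  by ring: sc.
- rewrite w'b; transitivity (2 * cos t * (sin t * bform w a)
    + (4 * cos t ^+ 2 - 1) * (sin t * bform w b)); first by ring.
  rewrite wa wb S3 S2 C2 C1 S1 S0.
  by ring: sc.
Qed.

Lemma word_act_braid i j v :
  word_act (flatten (nseq (M i j) [:: i; j])) v = v.
Proof.
have [Mii MC M1] := cs_matrix cs.
have [->|ij] := eqVneq i j; first by rewrite Mii /= reflection_simpleK.
have [->//|M0] := eqVneq (M i j) 0%N.
have M2 : (1 < M i j)%N.
  by move: (M1 _ _ ij) M0; case: (M i j) => [|[|]].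
have Mr0 : (M i j)%:R != 0 :> R by rewrite pnatr_eq0.
set t : R := pi / (M i j)%:R.
have gij : gram i j = - cos t by rewrite mxE (negbTE M0).
have st : 0 < sin t.
  apply: sin_gt0_pi; rewrite divr_gt0 ?pi_gt0 ?ltr0n ?lt0n//=.
  by rewrite ltr_pdivrMr ?ltr0n ?lt0n// ltr_pMr ?pi_gt0// ltr1n.
have [[p [q wE]] wa wb] := @iter_refl_pair i j (M i j) v t gij.
move: wE wa wb; set w := word_act _ _ => wE.
have tM : t * (2 * (M i j)%:R) = pi *+ 2.
  by rewrite /t mulrCA divfK// mulr_natl.
rewrite mulrBr mulrDr mulr1 tM.
rewrite sin2pi sinB sin2pi cos2pi sinD sin2pi cos2pi => wa wb.
have {}wa : bform w (simple_root i) = bform v (simple_root i).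
  by apply: (mulfI (lt0r_neq0 st)); rewrite wa; ring.
have {}wb : bform w (simple_root j) = bform v (simple_root j).
  by apply: (mulfI (lt0r_neq0 st)); rewrite wb; ring.
move: wa wb; rewrite {1 2}wE !bformDl !bformZl !bform_simple !gram_diag.
rewrite [gram j i]gramC gij => wa wb.
have pE : p = q * cos t by lra.
have qE : q = p * cos t by lra.
have q0 : q = 0.
  have : q * sin t ^+ 2 = 0 by rewrite sin2cos2 mulrBr mulr1 {1}qE pE; ring.
  by move/eqP; rewrite mulf_eq0 expf_eq0/= (gt_eqF st) orbF => /eqP.
by rewrite wE pE q0 mul0r !scale0r !addr0.
Qed.

Lemma word_act_equiv u1 u2 : cox_equiv M u1 u2 -> word_act u1 =1 word_act u2.
Proof.
elim=> [u|u v _ IH x|u v w _ IH1 _ IH2 x|u v i j x] //.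
- by rewrite IH1 IH2.
- by rewrite !word_act_cat word_act_braid.
Qed.

Lemma geom_act_word u : geom_act (word_prod u) =1 word_act u.
Proof.
apply: word_act_equiv; apply/cs_presentation; exact/eqP/(xchooseP (cs_gen cs _)).
Qed.

Lemma geom_actM w1 w2 v : geom_act (w1 * w2)%g v = geom_act w1 (geom_act w2 v).
Proof.
have [u1 /eqP <-] := cs_gen cs w1; have [u2 /eqP <-] := cs_gen cs w2.
rewrite -big_cat !(geom_act_word _ _) /=.
by rewrite -word_act_cat.
Qed.

Definition root_system : set V :=
  [set a | exists (w : W) (i : 'I_n), a = geom_act w (simple_root i)].

Definition pos_roots : set V :=
  [set a | root_system a /\ forall i, 0 <= a 0 i].

(* For a root a, the element of W acting on V as the reflection in a (it is
   unique because the geometric representation is faithful); if a is not a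
   root and no element acts as [reflection a], the value is 1. *)
Definition refl_elt (a : V) : W :=
  xget 1%g [set w | geom_act w = reflection a].

(* The increasing chain is 0 < l(s_a1) < l(s_a1 s_a2) < ... < l(s_a1 ... s_am),
   where as_ = [:: a1; ...; am]. *)
Definition pbr_preclosure (A : set V) : set V :=
  [set a | pos_roots a /\
    exists as_ : seq V,
      [/\ forall b, b \in as_ -> A b,
          refl_elt a = (\prod_(b <- as_) refl_elt b)%g,
          path ltn 0%N [seq ell cs (\prod_(b <- take k as_) refl_elt b)%g
                       | k <- iota 1 (size as_)]
        & rev as_ = as_]].

Definition two_closed (A : set V) : Prop :=
  A `<=` pos_roots /\
  forall (a b : V) (x y : R), A a -> A b -> 0 <= x -> 0 <= y ->
    pos_roots (x *: a + y *: b) -> A (x *: a + y *: b).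

Definition two_closure (A : set V) : set V := smallest two_closed A.

End GeometricRepresentation.

Arguments word_prod {W} cs u.
Arguments simple_root R {W} cs i.
Arguments bform {R W} cs u v.
Arguments reflection {R W} cs a v.
Arguments word_act {R W} cs u v.
Arguments geom_act {R W} cs w v.
Arguments root_system R {W} cs _.
Arguments pos_roots R {W} cs _.
Arguments refl_elt {R W} cs a.
Arguments pbr_preclosure {R W} cs A _.
Arguments two_closed {R W} cs A.
Arguments two_closure {R W} cs A _.

(* Main.v *)
Require Import Defs.
From mathcomp Require Import all_boot all_order fingroup all_algebra.
From mathcomp Require Import all_classical all_reals all_analysis.
From mathcomp Require Import ring lra zify.
Local Open Scope classical_set_scope.

(* A palindrome [t p rev(t)] of roots in [A] has as product the reflection in
   g = (s_{t_1} ... s_{t_m}) p, and its length chain is increasing exactly when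
   each b_r = s_{t_1} ... s_{t_(r-1)} t_r is a positive root made negative by s_g.
   From left to right: applied to the last letter [a] of [t], this forces
   (a, p) = -1/2, so [a, p, a] may be replaced by the root [p + a], and one
   concludes by induction.  From right to left: a root g in the 2-closure is a sum
   of elements of [A]; since (g, g) > 0 some summand c has (c, g) = 1/2, and
   g - c is again a root, so summands can be peeled off one by one.  Whatever
   choices are made, b_r and g - b_r are positive roots, because s_c sends a
   splitting of g - c into two positive roots to such a splitting of g. *)

(** * Words, parity and the length function *)

Section Length.
#[local] Set Implicit Arguments.
#[local] Unset Strict Implicit.
Variables (W : groupType) (cs : coxeterSystem W).
Local Open Scope group_scope.
Local Notation s := (simple_refl cs).
Local Notation ell := (ell cs).
Implicit Types w : W.

Lemma ell_word w : exists u, size u = ell w /\ word_prod cs u = w.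
Proof. by rewrite /ell; case: ex_minnP => k /asboolP. Qed.

Lemma ell_le_size u : ell (word_prod cs u) <= size u.
Proof.
by rewrite /ell; case: ex_minnP => k _; apply; apply/asboolP; exists u.
Qed.

Lemma word_prod_cat u v :
  word_prod cs (u ++ v) = word_prod cs u * word_prod cs v.
Proof. by rewrite /word_prod big_cat. Qed.

Lemma word_prod1 i : word_prod cs [:: i] = s i.
Proof. by rewrite /word_prod big_seq1. Qed.

Lemma word_prod_nil : word_prod cs [::] = 1.
Proof. by rewrite /word_prod big_nil. Qed.

(** Every relator [(s_i s_j)^(M i j)] has even length, so the relations preserve the parity of a
    word. *)
Lemma cox_equiv_odd_size u v :
  cox_equiv (cox_mx cs) u v -> odd (size u) = odd (size v).
Proof.
elim=> {u v} [//|//|u v w _ -> _ ->//|u v i j].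
by rewrite !size_cat !oddD size_flatten /shape map_nseq sumn_nseq oddM.
Qed.

Lemma odd_ell u : odd (ell (word_prod cs u)) = odd (size u).
Proof.
have [v [<- /cs_presentation vu]] := ell_word (word_prod cs u).
exact: cox_equiv_odd_size.
Qed.

Lemma braid_rel i j : word_prod cs (flatten (nseq (cox_mx cs i j) [:: i; j])) = 1.
Proof.
rewrite -word_prod_nil; apply/cs_presentation.
by have := cox_rel (cox_mx cs) [::] [::] i j; rewrite cats0.
Qed.

Lemma simple_reflK i : s i * s i = 1.
Proof.
have [Mii _ _] := cs_matrix cs; have := braid_rel i i.
by rewrite Mii /= /word_prod big_cons big_seq1.
Qed.

Lemma mul_simpleK i : involutive (fun w => w * s i).
Proof. by move=> w; rewrite -mulgA simple_reflK mulg1. Qed.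

Lemma simple_commute i j : cox_mx cs i j = 2 -> s i * s j = s j * s i.
Proof.
move=> Mij; have := braid_rel i j.
rewrite Mij /= /word_prod !big_cons big_nil mulg1 !mulgA => h.
apply: (mulIg (s i)); apply: (mulIg (s j)).
by rewrite h -[s j * s i * s i]mulgA simple_reflK mulg1 simple_reflK.
Qed.

Lemma simple_braid i j :
  cox_mx cs i j = 3 -> s i * s j * s i = s j * s i * s j.
Proof.
move=> Mij; have := braid_rel i j.
rewrite Mij /= /word_prod !big_cons big_nil mulg1 !mulgA => h.
by apply: (mulIg (s j)); apply: (mulIg (s i)); apply: (mulIg (s j));
   rewrite h !mul_simpleK simple_reflK.
Qed.

(** Lengths differ by at most one, since [s i] is an involution, and by parity they cannot agree. *)
Lemma ell_mul_simple w i :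
  ell (w * s i) = (ell w).+1 \/ ell w = (ell (w * s i)).+1.
Proof.
have bound w' : ell (w' * s i) <= (ell w').+1.
  have [u [<- <-]] := ell_word w'.
  by rewrite -word_prod1 -word_prod_cat -addn1 (leq_trans (ell_le_size _))// size_cat.
have h1 := bound w; have := bound (w * s i); rewrite mul_simpleK => h2.
have : odd (ell (w * s i)) = ~~ odd (ell w).
  have [u [_ <-]] := ell_word w.
  by rewrite -word_prod1 -word_prod_cat !odd_ell size_cat oddD addbT.
lia.
Qed.

Lemma ell_descent w : w <> 1 -> exists j, ell w = (ell (w * s j)).+1.
Proof.
have [u [su uw]] := ell_word w; rewrite -uw in su *.
case/lastP: u {uw} su => [|u j] su; first by rewrite word_prod_nil.
move=> _; exists j; rewrite -cats1 word_prod_cat word_prod1 mul_simpleK.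
case: (ell_mul_simple (word_prod cs u) j) => [->//|h].
move: su; rewrite size_rcons -cats1 word_prod_cat word_prod1.
by have := ell_le_size u; lia.
Qed.

Lemma ell1 : ell 1 = 0.
Proof. by apply/eqP; rewrite -leqn0 -word_prod_nil; exact: ell_le_size. Qed.

End Length.

(** * The geometric representation and its reflections *)

Section Geometry.
#[local] Set Implicit Arguments.
#[local] Unset Strict Implicit.
Import Order.TTheory GRing.Theory Num.Theory.
Local Open Scope ring_scope.
Variables (R : realType) (W : groupType) (cs : coxeterSystem W).
Local Notation n := (rank cs).
Local Notation V := 'rV[R]_n.
Local Notation act := (@geom_act R W cs).
Local Notation refl := (reflection cs).
Local Notation s := (simple_refl cs).
Local Notation e := (simple_root R cs).
Local Notation B := (@bform R W cs).
Local Notation ell := (ell cs).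
Implicit Types (u v a b : V) (w : W).

Lemma bformC u v : B u v = B v u.
Proof.
transitivity ((u *m gram R cs *m v^T)^T 0 0); first by rewrite [RHS]mxE.
rewrite !trmx_mul trmxK mulmxA; congr ((_ *m _ *m _) 0 0).
by apply/matrixP => i j; rewrite mxE gramC.
Qed.

Lemma bformDr u v a : B a (u + v) = B a u + B a v.
Proof. by rewrite bformC bformDl !(bformC a). Qed.

Lemma bformZr c u v : B v (c *: u) = c * B v u.
Proof. by rewrite bformC bformZl bformC. Qed.

Lemma bformNl u v : B (- u) v = - B u v.
Proof. by rewrite -scaleN1r bformZl mulN1r. Qed.

Lemma bformNr u v : B u (- v) = - B u v.
Proof. by rewrite bformC bformNl bformC. Qed.

Lemma bformBl u v a : B (u - v) a = B u a - B v a.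
Proof. by rewrite bformDl bformNl. Qed.

Lemma bformBr u v a : B a (u - v) = B a u - B a v.
Proof. by rewrite bformDr bformNr. Qed.

Lemma bform_suml (I : Type) (r : seq I) (F : I -> V) v :
  B (\sum_(i <- r) F i) v = \sum_(i <- r) B (F i) v.
Proof.
elim: r => [|i r IH]; last by rewrite !big_cons bformDl IH.
by rewrite !big_nil -(scale0r v) bformZl mul0r.
Qed.

Lemma bform_ee i : B (e i) (e i) = 1.
Proof. by rewrite bform_simple gram_diag. Qed.

Lemma reflectionD a u v : refl a (u + v) = refl a u + refl a v.
Proof. by rewrite /reflection bformDl mulrDr scalerDl opprD addrACA. Qed.

Lemma reflectionZ a c v : refl a (c *: v) = c *: refl a v.
Proof. by rewrite /reflection bformZl scalerBr scalerA; congr (_ - _ *: _); ring. Qed.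

Lemma reflection_id a : B a a = 1 -> refl a a = - a.
Proof.
by move=> aa; rewrite /reflection aa mulr1 scaler_nat mulr2n opprD addNKr.
Qed.

Lemma reflection_bform a u v : B a a = 1 -> B (refl a u) (refl a v) = B u v.
Proof.
move=> aa; rewrite /reflection !(bformBl, bformBr) !(bformZl, bformZr) aa.
by rewrite (bformC a v); ring.
Qed.

Lemma geom_act1 v : act 1%g v = v.
Proof. by rewrite -(word_prod_nil cs) geom_act_word. Qed.

Lemma geom_act_simple i v : act (s i) v = refl (e i) v.
Proof. by rewrite -word_prod1 geom_act_word. Qed.

Lemma geom_actK w : cancel (act w) (act w^-1%g).
Proof. by move=> v; rewrite -geom_actM mulVg geom_act1. Qed.

(** [P] ranges over operators, so linearity, isometry and integrality can be carried along a word
    without mentioning the word chosen in [geom_act]. *)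
Lemma geom_act_ind (P : (V -> V) -> Prop) :
  P id -> (forall i f, P f -> P (refl (e i) \o f)) -> forall w, P (act w).
Proof.
move=> P1 PM w; have [u /eqP <-] := cs_gen cs w.
elim: u => [|i u IH].
  by rewrite (_ : act _ = id)//; apply/funext => v; rewrite big_nil geom_act1.
rewrite big_cons (_ : act _ = refl (e i) \o act (\prod_(j <- u) s j)%g).
  exact: PM.
by apply/funext => v; rewrite geom_actM geom_act_simple.
Qed.

Lemma geom_actD w u v : act w (u + v) = act w u + act w v.
Proof.
move: u v; apply: (geom_act_ind (P := fun f => forall u v, f (u + v) = f u + f v)) => //.
by move=> i f fD u v /=; rewrite fD reflectionD.
Qed.

Lemma geom_actZ w c v : act w (c *: v) = c *: act w v.
Proof.
move: v; apply: (geom_act_ind (P := fun f => forall v, f (c *: v) = c *: f v)) => //.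
by move=> i f fD v /=; rewrite fD reflectionZ.
Qed.

Lemma geom_actN w v : act w (- v) = - act w v.
Proof. by rewrite -scaleN1r geom_actZ scaleN1r. Qed.

Lemma geom_actB w u v : act w (u - v) = act w u - act w v.
Proof. by rewrite geom_actD geom_actN. Qed.

Lemma geom_act_bform w u v : B (act w u) (act w v) = B u v.
Proof.
move: u v; apply: (geom_act_ind (P := fun f => forall u v, B (f u) (f v) = B u v)) => //.
by move=> i f fD u v /=; rewrite reflection_bform ?bform_ee ?fD.
Qed.

Lemma geom_act_reflection w a v :
  act w (refl a (act w^-1%g v)) = refl (act w a) v.
Proof.
rewrite /reflection geom_actB geom_actZ -geom_actM mulgV geom_act1.
by rewrite -(geom_act_bform w (act _ v)) -geom_actM mulgV geom_act1.
Qed.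

Lemma root_norm a : root_system R cs a -> B a a = 1.
Proof. by move=> [w [i ->]]; rewrite geom_act_bform bform_ee. Qed.

Lemma root_geom_act w a : root_system R cs a -> root_system R cs (act w a).
Proof. by move=> [w' [i ->]]; exists (w * w')%g, i; rewrite geom_actM. Qed.

Lemma root_simple i : root_system R cs (e i).
Proof. by exists 1%g, i; rewrite geom_act1. Qed.

Lemma root_neq0 a : root_system R cs a -> a <> 0.
Proof.
move=> /root_norm aa a0; have : B a a = 0 by rewrite {1}a0 -(scale0r a) bformZl mul0r.
by rewrite aa => /eqP; rewrite oner_eq0.
Qed.

Lemma refl_eltP a : root_system R cs a -> forall v, act (refl_elt cs a) v = refl a v.
Proof.
move=> [w [i ai]] v; rewrite /refl_elt; case: xgetP => [t _ /= ->//|h].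
case: (h (w * s i * w^-1)%g); apply/funext => x.
by rewrite !geom_actM geom_act_simple geom_act_reflection ai.
Qed.

Lemma root_reflection a b : root_system R cs a -> root_system R cs b ->
  root_system R cs (refl a b).
Proof. by move=> ra rb; rewrite -refl_eltP//; exact: root_geom_act. Qed.

Lemma reflection_eq a b : root_system R cs a -> root_system R cs b ->
  refl a =1 refl b -> a = b \/ a = - b.
Proof.
move=> ra rb /(_ a); rewrite reflection_id ?root_norm// /reflection => h.
(* Evaluating both reflections at [a] makes [a] a multiple of [b]; unit norms then force the
   coefficient to be 1 or -1. *)
have aE : a = B a b *: b.
  apply: (@scalerI _ _ 2); first by rewrite pnatr_eq0.
  by rewrite scalerA; apply/eqP; rewrite -subr_eq0 scaler_nat mulr2n -addrA -h subrr.
have /eqP : (B a b) ^+ 2 = 1.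
  by have := root_norm ra; rewrite {1}aE bformZl bformC.
rewrite sqrf_eq1 => /orP[] /eqP c; first by left; rewrite {1}aE c scale1r.
by right; rewrite {1}aE c scaleN1r.
Qed.

(** * Positive roots and strong exchange *)

Definition nonneg v := forall i, 0 <= v 0 i.

Lemma nonnegD u v : nonneg u -> nonneg v -> nonneg (u + v).
Proof. by move=> u0 v0 i; rewrite mxE addr_ge0. Qed.

Lemma nonneg_simple i : nonneg (e i).
Proof. by move=> j; rewrite mxE; case: (_ && _) => /=; rewrite ?ler01. Qed.

Lemma nonneg_root_opp a : root_system R cs a -> nonneg a -> ~ nonneg (- a).
Proof.
move=> ra a0 Na0; apply: (root_neq0 ra); apply/rowP => i.
rewrite [RHS]mxE; apply/eqP; rewrite eq_le a0 andbT -oppr_ge0.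
by have := Na0 i; rewrite mxE.
Qed.

(** With c = cos (pi / 3), the triple-angle formula turns cos pi = -1 into 4c^3 - 3c + 1 = (c +
    1)(2c - 1)^2 = 0, and c > 0 leaves c = 1/2. *)
Lemma cos_pi3 : cos (pi / 3) = 2^-1 :> R.
Proof.
set t : R := pi / 3; have t3 : t + t *+ 2 = pi by rewrite /t; field.
have c0 : 0 < cos t.
  by apply: cos_gt0_pihalf; have := pi_gt0 R; rewrite /t => ?; apply/andP; split; lra.
have := cospi R; rewrite -t3 cosD cos_mulr2n sin_mulr2n => h.
have sc : sin t ^+ 2 = 1 - cos t ^+ 2 := sin2cos2 t.
have : (cos t + 1) * (2 * cos t - 1) ^+ 2 = 0.
  have -> : (cos t + 1) * (2 * cos t - 1) ^+ 2 = 4 * cos t ^+ 3 - 3 * cos t + 1 by ring.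
  have : cos t * (cos t ^+ 2 *+ 2 - 1) - sin t * (cos t * sin t *+ 2)
    = 4 * cos t ^+ 3 - 3 * cos t by ring: sc.
  by rewrite h => <-; rewrite addNr.
move=> /eqP; rewrite mulf_eq0 expf_eq0/= => /orP[] /eqP; lra.
Qed.

Hypothesis hsl : simply_laced cs.

Lemma gram_simply_laced i j : i != j ->
  (cox_mx cs i j = 2%N /\ gram R cs i j = 0) \/
  (cox_mx cs i j = 3%N /\ gram R cs i j = - 2^-1).
Proof.
by move=> ij; rewrite mxE; case: (hsl ij) => ->/=; [left|right];
  rewrite ?cos_pihalf ?cos_pi3 ?oppr0.
Qed.

(** Induction on length: strip a right descent [j] from [w] and compute in the dihedral group of [i]
    and [j], which has order 4 or 6. This is the source of the dichotomy of roots and of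
    faithfulness. *)
Lemma geom_act_nonneg w i : (ell w < ell (w * s i)%g)%N -> nonneg (act w (e i)).
Proof.
have [k] := ubnP (ell w); elim: k w i => // k IH w i wk wi.
have [->|/eqP w1] := eqVneq w 1%g; first by rewrite geom_act1; exact: nonneg_simple.
have [j wj] := ell_descent cs w1.
have ij : i != j by apply/eqP => ij; move: wi; rewrite ij; lia.
set w' := (w * s j)%g in wj; have wE : w = (w' * s j)%g by rewrite /w' mul_simpleK.
clearbody w'.
have ej : nonneg (act w' (e j)) by apply: IH; rewrite -?wE; lia.
have gji : B (e i) (e j) = gram R cs i j by rewrite bform_simple.
have [[m2 g0]|[m3 gh]] := gram_simply_laced ij.
  rewrite wE geom_actM geom_act_simple /reflection gji g0 mulr0 scale0r subr0.
  apply: IH; first by lia.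
  have wsi : (w' * s i * s j = w * s i)%g by rewrite -mulgA simple_commute// mulgA -wE.
  by have := ell_mul_simple (w' * s i)%g j; rewrite wsi; lia.
have sji : act (s j) (e i) = e i + e j.
  by rewrite geom_act_simple /reflection gji gh mulrN divff ?pnatr_eq0// scaleN1r opprK.
have [w'i|w'i] := ell_mul_simple w' i.
  by rewrite wE geom_actM sji geom_actD; apply: (nonnegD _ ej); apply: IH; lia.
(* Here [i] is a descent of [w'], so w = w'' s_i s_j and w sends e_i to w'' e_j. The braid relation
   w s_i = w'' s_j s_i s_j, of length ell w'' + 3, shows that [j] is not a descent of [w'']. *)
set w'' := (w' * s i)%g in w'i.
have w'E : w' = (w'' * s i)%g by rewrite /w'' mul_simpleK.
clearbody w''.
have sij : act (s i) (e i + e j) = e j.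
  rewrite geom_act_simple /reflection bformDl bform_ee bformC gji gh.
  by rewrite [_ * _](_ : _ = 1) ?scale1r 1?addrC ?addKr//; field.
rewrite wE w'E !geom_actM sji sij; apply: IH; first by lia.
have h : (w * s i)%g = (w'' * s j * s i * s j)%g.
  transitivity (w'' * (s i * s j * s i))%g; first by rewrite wE w'E !mulgA.
  by rewrite simple_braid// !mulgA.
have := ell_mul_simple (w'' * s j * s i)%g j; have := ell_mul_simple (w'' * s j)%g i.
by rewrite -h; have := ell_mul_simple w'' j; lia.
Qed.

Lemma root_dichotomy a : root_system R cs a -> nonneg a \/ nonneg (- a).
Proof.
move=> [w [i ->]]; case: (ell_mul_simple w i) => h.
  by left; apply: geom_act_nonneg; rewrite h.
right; have : nonneg (act (w * s i)%g (e i)).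
  by apply: geom_act_nonneg; rewrite mul_simpleK h.
by rewrite geom_actM geom_act_simple reflection_id ?bform_ee// geom_actN.
Qed.

Lemma geom_act_faithful w : (forall v, act w v = v) -> w = 1%g.
Proof.
move=> w1; have [//|/eqP wn1] := eqVneq w 1%g.
have [j wj] := ell_descent cs wn1.
(* If [w] acted trivially, this vector would be - e_j. *)
have : nonneg (act (w * s j)%g (e j)).
  by apply: geom_act_nonneg; rewrite mul_simpleK wj.
rewrite geom_actM w1 geom_act_simple reflection_id ?bform_ee//.
by case/(nonneg_root_opp (root_simple j) (nonneg_simple j)).
Qed.

Lemma geom_act_inj w w' : (forall v, act w v = act w' v) -> w = w'.
Proof.
move=> ww'; apply: (mulgI w'^-1%g); rewrite mulVg; apply: geom_act_faithful => v.
by rewrite geom_actM ww' geom_actK.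
Qed.

Lemma refl_elt_geom_act w a : root_system R cs a ->
  refl_elt cs (act w a) = (w * refl_elt cs a * w^-1)%g.
Proof.
move=> ra; have rwa := root_geom_act w ra; apply: geom_act_inj => v.
by rewrite !geom_actM !refl_eltP// geom_act_reflection.
Qed.

Lemma refl_elt_simple i : refl_elt cs (e i) = s i.
Proof.
by apply: geom_act_inj => v; rewrite refl_eltP ?geom_act_simple//; exact: root_simple.
Qed.

Lemma refl_eltK a : root_system R cs a -> (refl_elt cs a * refl_elt cs a = 1)%g.
Proof.
move=> [w [i ->]]; rewrite (refl_elt_geom_act w (root_simple i)) refl_elt_simple.
by rewrite !mulgA mulgVK mul_simpleK mulgV.
Qed.

Lemma refl_eltV a : root_system R cs a -> ((refl_elt cs a)^-1 = refl_elt cs a)%g.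
Proof. by move=> ra; apply: (mulgI (refl_elt cs a)); rewrite mulgV refl_eltK. Qed.

Lemma nonneg_reflection_simple a i : root_system R cs a -> nonneg a -> a <> e i ->
  nonneg (refl (e i) a).
Proof.
move=> ra a0 ai; have ri := root_simple i.
have [//|N] := root_dichotomy (root_reflection ri ra).
(* The reflection changes only coordinate [i], so a negative image leaves [a] no other support. *)
have a_supp j : j != i -> a 0 j = 0.
  move=> ji; apply/eqP; rewrite eq_le a0 andbT.
  have := N j; rewrite !mxE/= (negbTE ji) mulr0 oppr0 addr0.
  by rewrite oppr_ge0.
have aE : a = a 0 i *: e i.
  apply/rowP => j; rewrite !mxE/=; have [->|ji] := eqVneq j i; first by rewrite mulr1.
  by rewrite mulr0 a_supp.
have := root_norm ra; rewrite aE bformZl bformZr bform_ee mulr1 -expr2 => /eqP.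
rewrite sqrf_eq1 => /orP[] /eqP c; first by case: ai; rewrite aE c scale1r.
by have := a0 i; rewrite c; lra.
Qed.

(* Strong exchange: along a reduced word of [w], the image of [a] first becomes
   negative when it is the simple root of the letter being applied. *)
Lemma ell_mul_refl_lt w a : root_system R cs a -> nonneg a -> nonneg (- act w a) ->
  (ell (w * refl_elt cs a)%g < ell w)%N.
Proof.
move=> ra a0; have [u [<- <-]] := ell_word cs w.
suff: nonneg (- act (word_prod cs u) a) -> exists2 v, (size v < size u)%N &
    word_prod cs v = (word_prod cs u * refl_elt cs a)%g.
  by move=> + h => /(_ h) [v vu <-]; exact: leq_ltn_trans (ell_le_size v) vu.
elim: u => [|i u IH].
  by rewrite word_prod_nil geom_act1 => /(nonneg_root_opp ra a0).
have wE : word_prod cs (i :: u) = (s i * word_prod cs u)%g by rewrite /word_prod big_cons.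
rewrite wE geom_actM geom_act_simple => N.
have rua : root_system R cs (act (word_prod cs u) a) by exact: root_geom_act.
have [ua0|ua0] := root_dichotomy rua; last first.
  have [v vu vE] := IH ua0; exists (i :: v) => //.
  by rewrite -mulgA -vE /word_prod big_cons.
have [uai|uai] := EM (act (word_prod cs u) a = e i); last first.
  have := nonneg_reflection_simple rua ua0 uai.
  by move=> /(nonneg_root_opp (root_reflection (root_simple i) rua)).
exists u; rewrite //= -refl_elt_simple -uai refl_elt_geom_act// mulgVK.
by rewrite -mulgA refl_eltK// mulg1.
Qed.

(** Each direction is [ell_mul_refl_lt], the second one applied to w s_a, which sends [a] to - w
    a. *)
Lemma ell_mul_refl w a : pos_roots R cs a ->
  (ell w < ell (w * refl_elt cs a)%g)%N <-> pos_roots R cs (act w a).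
Proof.
move=> [ra a0]; have rwa := root_geom_act w ra; split=> [h|[_ wa0]].
  split=> //; have [//|N] := root_dichotomy rwa.
  by have := ell_mul_refl_lt ra a0 N; lia.
have := @ell_mul_refl_lt (w * refl_elt cs a)%g a ra a0.
rewrite -mulgA refl_eltK// mulg1; apply.
by rewrite geom_actM refl_eltP// reflection_id ?root_norm// geom_actN opprK.
Qed.

End Geometry.

(** * Inner products of roots *)

Section SimplyLaced.
#[local] Set Implicit Arguments.
#[local] Unset Strict Implicit.
Import Order.TTheory GRing.Theory Num.Theory.
Local Open Scope ring_scope.
Variables (R : realType) (W : finGroupType) (cs : coxeterSystem W).
Local Notation V := 'rV[R]_(rank cs).
Local Notation act := (@geom_act R W cs).
Local Notation refl := (reflection cs).
Local Notation B := (@bform R W cs).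
Local Notation root := (root_system R cs).
Local Notation pos := (pos_roots R cs).
Implicit Types (u v a b d g : V) (w : W).

(* A W-invariant inner product; positive definiteness of the form [bform] itself
   is never needed, because the two agree on pairs of roots up to a scalar. *)
Definition avg_form u v : R :=
  \sum_(w : W) \sum_k act w u 0 k * act w v 0 k.

Lemma avg_formC u v : avg_form u v = avg_form v u.
Proof. by apply: eq_bigr => w _; apply: eq_bigr => k _; rewrite mulrC. Qed.

Lemma avg_formD u v a : avg_form (u + v) a = avg_form u a + avg_form v a.
Proof.
rewrite -big_split; apply: eq_bigr => w _; rewrite -big_split.
by apply: eq_bigr => k _; rewrite geom_actD mxE mulrDl.
Qed.

Lemma avg_formZ c u a : avg_form (c *: u) a = c * avg_form u a.
Proof.
rewrite mulr_sumr; apply: eq_bigr => w _; rewrite mulr_sumr.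
by apply: eq_bigr => k _; rewrite geom_actZ mxE mulrA.
Qed.

Lemma avg_form_act w u v : avg_form (act w u) (act w v) = avg_form u v.
Proof.
rewrite [RHS](reindex_inj (mulIg w)); apply: eq_bigr => w' _.
by rewrite !geom_actM.
Qed.

Lemma avg_form_ge0 u : 0 <= avg_form u u.
Proof. by do 2 apply: sumr_ge0 => ? _; rewrite -expr2 sqr_ge0. Qed.

Lemma avg_form_eq0 u : avg_form u u = 0 -> u = 0.
Proof.
have sq w k : 0 <= act w u 0 k * act w u 0 k by rewrite -expr2 sqr_ge0.
move/eqP; rewrite psumr_eq0 => [/allP|w _]; last exact: sumr_ge0.
move=> /(_ 1%g (mem_index_enum _)) /=; rewrite psumr_eq0// => /allP h.
apply/rowP => k; have := h k (mem_index_enum _).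
by rewrite geom_act1 mulf_eq0 orbb mxE => /eqP.
Qed.

(** Invariance under s_a, which negates [a], determines the pairing of any vector with [a]. *)
Lemma avg_form_root a v : root a -> avg_form v a = B v a * avg_form a a.
Proof.
move=> ra; have := avg_form_act (refl_elt cs a) v a.
rewrite !refl_eltP// (reflection_id (root_norm ra)) reflectionE.
rewrite avg_formD avg_formZ ![avg_form _ (- a)]avg_formC.
rewrite -scaleN1r !avg_formZ [avg_form a v]avg_formC; lra.
Qed.

(** Strict Cauchy-Schwarz for [avg_form]: non-orthogonal roots have the same averaged norm, and the
    component of [a] orthogonal to [b] has positive norm unless a = b or a = - b. *)
Lemma bform_root_sqr a b : root a -> root b -> a <> b -> a <> - b -> B a b ^+ 2 < 1.
Proof.
move=> ra rb ab aNb; have [->|B0] := eqVneq (B a b) 0; first by rewrite expr0n/= ltr01.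
have nn : avg_form a a = avg_form b b.
  by apply: (mulfI B0); rewrite -(avg_form_root a rb) bformC -(avg_form_root b ra) avg_formC.
have n0 : 0 < avg_form b b.
  by rewrite lt_def avg_form_ge0 andbT; apply/eqP => /avg_form_eq0; exact: root_neq0.
have E : avg_form (a + (- B a b) *: b) (a + (- B a b) *: b)
    = (1 - B a b ^+ 2) * avg_form b b.
  rewrite avg_formD avg_formZ ![avg_form _ (_ + _)]avg_formC !avg_formD !avg_formZ.
  by rewrite [avg_form b a]avg_formC (avg_form_root a rb) nn; ring.
rewrite lt_neqAle; apply/andP; split.
  apply/eqP => B1; move: E; rewrite B1 subrr mul0r => /avg_form_eq0 /eqP.
  rewrite scaleNr subr_eq0 => /eqP aE; move/eqP: B1; rewrite sqrf_eq1.
  by case/orP => /eqP c; rewrite c ?scale1r ?scaleN1r in aE.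
by rewrite -subr_ge0 -(pmulr_lge0 _ n0) -E avg_form_ge0.
Qed.

Hypothesis hsl : simply_laced cs.

Definition integral v := forall i, v 0 i \is a Num.int.

Lemma integral_bform u v : integral u -> integral v -> 2 * B u v \is a Num.int.
Proof.
move=> ui vi; rewrite /bform mxE mulr_sumr; apply: rpred_sum => j _.
rewrite [v^T _ _]mxE mxE mulrA mulr_sumr rpredM//; apply: rpred_sum => i _.
rewrite mulrCA rpredM//; have [->|ij] := eqVneq i j.
  by rewrite gram_diag mulr1 rpred_nat.
have [[_ ->]|[_ ->]] := gram_simply_laced R hsl ij; first by rewrite mulr0 rpred0.
by rewrite mulrN divff ?pnatr_eq0// rpredN rpred1.
Qed.

Lemma root_integral a : root a -> integral a.
Proof.
have ei i : integral (simple_root R cs i).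
  by move=> j; rewrite mxE; case: (_ && _); rewrite ?rpred0 ?rpred1.
move=> [w [i ->]].
move: (ei i); move: (simple_root R cs i).
apply: (geom_act_ind (P := fun f => forall v, integral v -> integral (f v))) => //.
move=> {}i f IH v vi j; rewrite /= /reflection !mxE rpredB ?IH// rpredM//.
  by apply: integral_bform; [exact: IH|exact: ei].
by have := ei i j; rewrite mxE.
Qed.

Lemma bform_root a b : root a -> root b -> a <> b -> a <> - b ->
  [\/ B a b = 0, B a b = 2^-1 | B a b = - 2^-1].
Proof.
move=> ra rb ab aNb; have B1 := bform_root_sqr ra rb ab aNb.
have /intrP[m mE] := integral_bform (root_integral ra) (root_integral rb).
(* The integer m is 2 (a, b), and (a, b)^2 < 1 leaves only -1, 0 and 1. *)
have m4 : (m * m < 4)%R.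
  by rewrite -(ltr_int R) intrM -mE; nra.
have : m = 0 \/ m = 1 \/ m = -1 by nia.
by case=> [|[]] m1; rewrite m1 in mE; [apply: Or31|apply: Or32|apply: Or33]; lra.
Qed.

Lemma pos_neq_opp a b : pos a -> pos b -> a <> - b.
Proof. by move=> [_ a0] [rb b0] ab; apply: (nonneg_root_opp rb b0); rewrite -ab. Qed.

Lemma bform_pos a b : pos a -> pos b -> a <> b ->
  [\/ B a b = 0, B a b = 2^-1 | B a b = - 2^-1].
Proof. by move=> pa pb; move=> ab; apply: (bform_root pa.1 pb.1 ab); exact: pos_neq_opp. Qed.

Lemma root_add a b : root a -> root b -> B a b = - 2^-1 -> root (a + b).
Proof.
move=> ra rb ab; have := root_reflection rb ra.
by rewrite /reflection ab mulrN divff ?pnatr_eq0// scaleN1r opprK.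
Qed.

Lemma root_sub a b : root a -> root b -> B a b = 2^-1 -> root (a - b).
Proof.
move=> ra rb ab; have := root_reflection rb ra.
by rewrite /reflection ab divff ?pnatr_eq0// scale1r.
Qed.

Lemma posD a b : pos a -> pos b -> B a b = - 2^-1 -> pos (a + b).
Proof. by move=> [ra a0] [rb b0] ab; split; [exact: root_add|exact: nonnegD]. Qed.

Lemma bform_add_root a b : root a -> root b -> root (a + b) -> B a b = - 2^-1.
Proof.
move=> /root_norm aa /root_norm bb /root_norm.
by rewrite bformDl !bformDr (bformC b a) aa bb => ?; lra.
Qed.

(** This reduces the real coefficients of 2-closedness to plain sums. If g differs from [a] and [b],
    its products with them are at most 1/2, while x (g, a) + y (g, b) = (g, g) = 1, so x + y >=
    2. *)
Lemma pos_combination a b (x y : R) : pos a -> pos b -> 0 <= x -> 0 <= y ->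
  pos (x *: a + y *: b) ->
  [\/ x *: a + y *: b = a, x *: a + y *: b = b | x *: a + y *: b = a + b].
Proof.
move=> pa pb x0 y0; set g := x *: a + y *: b => pg.
have [aa bb gg] := And3 (root_norm pa.1) (root_norm pb.1) (root_norm pg.1).
have ga : B g a = x + y * B a b by rewrite /g bformDl !bformZl aa mulr1 (bformC b).
have gb : B g b = x * B a b + y by rewrite /g bformDl !bformZl bb mulr1.
have gE : x * B g a + y * B g b = 1.
  by rewrite -!bformZr -bformDr.
have [|gna] := EM (g = a); first by apply: Or31.
have [|gnb] := EM (g = b); first by apply: Or32.
have ga2 : B g a <= 2^-1 by case: (bform_pos pg pa gna) => ->; lra.
have gb2 : B g b <= 2^-1 by case: (bform_pos pg pb gnb) => ->; lra.
have [ab|ab] := EM (a = b).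
  by exfalso; move: ga ga2 gE; rewrite -ab aa => -> ? ?; nra.
apply: Or33; have xy : 2 <= x + y by nra.
(* If (a, b) >= 0 then 1 = (g, g) >= x^2 + y^2 >= (x + y)^2 / 2 >= 2. *)
have hab : B a b = - 2^-1.
  by case: (bform_pos pa pb ab) => // h; exfalso; move: gE; rewrite ga gb h; nra.
move: gE; rewrite ga gb hab => gE.
(* Now 1 = x^2 - x y + y^2 = (x + y)^2 / 4 + 3 (x - y)^2 / 4, whose first term is already at least
   1. *)
have exy : (x - y) ^+ 2 <= 0 by nra.
have {}exy : x = y.
  by apply/eqP; rewrite -subr_eq0 -sqrf_eq0 eq_le exy sqr_ge0.
have x1 : x = 1 by nra.
by rewrite /g -exy x1 !scale1r.
Qed.

End SimplyLaced.

(** Peel off the two equal end letters. The even shape is excluded later, its product of reflections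
    being trivial. *)
Lemma palindromeP (T : Type) (t : seq T) : rev t = t ->
  exists s, t = s ++ rev s \/ exists p, t = s ++ p :: rev s.
Proof.
have [k] := ubnP (size t); elim: k t => // k IH [|a t] tk; first by exists [::]; left.
case/lastP: t tk => [|t b] tk; first by exists [::]; right; exists a.
rewrite rev_cons rev_rcons rcons_cons => -[-> /rcons_inj-[tt]].
have {}tk : size t < k by move: tk; rewrite /= size_rcons; lia.
have [s st] := IH t tk tt.
exists (a :: s); rewrite rev_cons -cats1.
by case: st => [->|[p ->]]; [left|right; exists p]; rewrite /= -!cats1 -!catA.
Qed.

(** * Palindromic chains *)

Section PalindromicChains.
#[local] Set Implicit Arguments.
#[local] Unset Strict Implicit.
Import Order.TTheory GRing.Theory Num.Theory.
Local Open Scope ring_scope.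
Variables (R : realType) (W : finGroupType) (cs : coxeterSystem W).
Hypothesis hsl : simply_laced cs.
Local Notation V := 'rV[R]_(rank cs).
Local Notation act := (@geom_act R W cs).
Local Notation refl := (reflection cs).
Local Notation B := (@bform R W cs).
Local Notation root := (root_system R cs).
Local Notation pos := (pos_roots R cs).
Local Notation rprod t := (\prod_(b <- t) refl_elt cs b)%g.
Implicit Types (u v a b d g p : V) (s t : seq V) (w x y : W).

(** The length chain rewritten through [ell_mul_refl]: [x] is the product read so far, and the next
    letter [a] increases the length exactly when x a is positive. *)
Fixpoint ascending x t : Prop :=
  if t is a :: t' then pos (act x a) /\ ascending (x * refl_elt cs a)%g t' else True.

Lemma ascending_path x t : (forall b, b \in t -> pos b) ->
  path ltn (ell cs x)
    [seq ell cs (x * rprod (take k t))%g | k <- iota 1 (size t)] <-> ascending x t.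
Proof.
elim: t x => [//|a t IH] x tpos /=.
have {}IH := IH (x * refl_elt cs a)%g (fun b bt => tpos b (@mem_behead _ (a :: t) b bt)).
rewrite take0 big_seq1 (iotaDl 1 1) -map_comp.
have -> : [seq (ell cs \o (fun k => x * rprod (take k (a :: t)))%g \o addn 1) k
    | k <- iota 1 (size t)] =
  [seq ell cs (x * refl_elt cs a * rprod (take k t))%g | k <- iota 1 (size t)].
  by apply: eq_map => k /=; rewrite big_cons mulgA.
have := ell_mul_refl hsl x (tpos a (mem_head _ _)).
split=> [/andP[h1 h2]|[h1 h2]]; first by split; [apply/H|apply/IH].
by apply/andP; split; [apply/H|apply/IH].
Qed.

Lemma ascending_cat x s t :
  ascending x (s ++ t) <-> ascending x s /\ ascending (x * rprod s)%g t.
Proof.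
elim: s x => [|a s IH] x /=; first by rewrite big_nil mulg1; tauto.
by rewrite IH big_cons mulgA; tauto.
Qed.

(* For [t = [:: a_1; ...; a_m]] this lists the roots [s_{a_1} ... s_{a_(r-1)} a_r]. *)
Fixpoint path_roots t : seq V :=
  if t is a :: t' then a :: map (act (refl_elt cs a)) (path_roots t') else [::].

Lemma path_roots_rcons t a :
  path_roots (rcons t a) = rcons (path_roots t) (act (rprod t) a).
Proof.
elim: t => [|c t IH] /=; first by rewrite big_nil geom_act1.
by rewrite IH map_rcons big_cons geom_actM.
Qed.

Lemma ascending_path_roots x t :
  ascending x t <-> forall b, b \in path_roots t -> pos (act x b).
Proof.
elim: t x => [//|a t IH] x /=; rewrite IH; split=> [[xa xt] b|h].
  by rewrite inE => /predU1P[->//|/mapP[c ct ->]]; rewrite -geom_actM; exact: xt.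
split=> [|b bt]; first by apply: h; rewrite mem_head.
by rewrite geom_actM; apply: h; rewrite inE map_f ?orbT.
Qed.

Lemma prod_rev_refl t : (forall b, b \in t -> root b) -> rprod (rev t) = (rprod t)^-1%g.
Proof.
elim: t => [|a t IH] tr; first by rewrite big_nil invg1.
have ra : root a by apply: tr; rewrite mem_head.
rewrite rev_cons -cats1 big_cat big_seq1 big_cons invMg (refl_eltV hsl ra).
by rewrite IH// => b bt; apply: tr; rewrite inE bt orbT.
Qed.

(** On reading [rev t], the product just before the letter a_r has cancelled down to y s_{a_1} ...
    s_{a_r}, which sends a_r to - y b_r, where b_r is the r-th path root. *)
Lemma ascending_rev y t : (forall b, b \in t -> root b) ->
  ascending (y * rprod t)%g (rev t) <->
  forall b, b \in path_roots t -> pos (- act y b).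
Proof.
elim: t y => [//|a t IH] y tr.
have ra : root a by apply: tr; rewrite mem_head.
have {}tr b : b \in t -> root b by move=> bt; apply: tr; rewrite inE bt orbT.
rewrite big_cons mulgA rev_cons -cats1 ascending_cat (IH _ tr) /= prod_rev_refl// mulgK.
rewrite geom_actM refl_eltP// reflection_id ?root_norm// geom_actN.
split=> [[h [ya _]] b|h].
  by rewrite inE => /predU1P[->//|/mapP[c ct ->]]; rewrite -geom_actM; exact: h.
split=> [b bt|]; first by rewrite geom_actM; apply: h; rewrite inE map_f ?orbT.
by split=> //; apply: h; rewrite mem_head.
Qed.

Lemma refl_elt_palindrome t p :
  (forall b, b \in t -> root b) -> root p ->
  rprod (t ++ p :: rev t) = refl_elt cs (act (rprod t) p).
Proof.
move=> tr rp; rewrite (refl_elt_geom_act hsl)//.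
by rewrite big_cat big_cons prod_rev_refl//= mulgA.
Qed.

Lemma ascending_palindrome t p : let g := act (rprod t) p in
  (forall b, b \in t -> root b) -> root p ->
  ascending 1%g (t ++ p :: rev t) <->
  pos g /\ forall b, b \in path_roots t -> pos b /\ pos (- refl g b).
Proof.
move=> g tr rp; have rg : root g by exact: root_geom_act.
rewrite ascending_cat mul1g /= ascending_path_roots -/g.
(* Past the middle letter, the prefix has the form required by [ascending_rev] with y = s_g. *)
have -> : (rprod t * refl_elt cs p = refl_elt cs g * rprod t)%g.
  by rewrite (refl_elt_geom_act hsl)// mulgVK.
rewrite (ascending_rev _ tr).
split=> [[h1 [pg h2]]|[pg h]].
  split=> // b bt; rewrite -refl_eltP//; split; last exact: h2.
  by rewrite -(geom_act1 b); exact: h1.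
split=> [b bt|]; first by rewrite geom_act1; have [] := h b bt.
by split=> // b bt; rewrite refl_eltP//; have [] := h b bt.
Qed.

Lemma palindrome_two_closed (C : set V) t p : two_closed cs C ->
  (forall b, b \in t -> C b) -> C p -> let g := act (rprod t) p in
  pos g -> (forall b, b \in path_roots t -> pos b /\ pos (- refl g b)) -> C g.
Proof.
move=> [Cpos Cadd]; elim/last_ind: t p => [|t a IH] p tC Cp g pg gt.
  by rewrite /g big_nil geom_act1.
have Ca : C a by apply: tC; rewrite mem_rcons mem_head.
have [pa pp] := (Cpos _ Ca, Cpos _ Cp).
have gE : g = act (rprod t) (refl a p).
  by rewrite /g -cats1 big_cat big_seq1 geom_actM refl_eltP//; case: pa.
set b := act (rprod t) a.
have [] := gt b; first by rewrite path_roots_rcons mem_rcons mem_head.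
move=> pb [_ Nb].
(* Both are images under [rprod t]: (b, g) = (a, s_a p) = (s_a a, p). *)
have gb : B b g = - B a p.
  rewrite /b gE geom_act_bform -{1}(opprK a) bformNl -(reflection_id (root_norm pa.1)).
  by rewrite reflection_bform ?root_norm//; case: pa.
(* It suffices that (b, g) = 1/2. If it were 0, then - s_g b = - b; if it were -1/2, then - s_g b =
   - b - g, and adding g gives - b. Neither is possible for positive [b]. *)
have ap : B a p = - 2^-1.
  have ap1 : B a p <> -1.
    have [->|ap] := EM (a = p); first by rewrite (root_norm pp.1); lra.
    by case: (bform_pos hsl pa pp ap) => ->; lra.
  have bg : b <> g by move=> bg; move: gb; rewrite bg (root_norm pg.1); lra.
  have Nb0 : ~ nonneg (- b) := nonneg_root_opp pb.1 pb.2.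
  case: (bform_pos hsl pb pg bg) => h; rewrite /reflection h in Nb.
  - by case: Nb0; move: Nb; rewrite mulr0 scale0r subr0.
  - by move: gb; rewrite h; lra.
  - case: Nb0; have := nonnegD Nb pg.2.
    by rewrite mulrN divff ?pnatr_eq0// scaleN1r opprK opprD subrK.
have apE : refl a p = 1 *: p + 1 *: a.
  by rewrite /reflection bformC ap mulrN divff ?pnatr_eq0// scaleN1r opprK !scale1r.
rewrite gE; apply: IH; rewrite -?gE//.
- by move=> c ct; apply: tC; rewrite mem_rcons inE ct orbT.
- rewrite apE; apply: Cadd => //; rewrite !scale1r; apply: posD => //.
  by rewrite bformC.
by move=> c ct; apply: gt; rewrite path_roots_rcons mem_rcons inE ct orbT.
Qed.

(** Since (a, d) + (a, g - d) = -1/2 and both terms lie in {0, 1/2, -1/2}, s_a fixes one summand and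
    adds [a] to the other. *)
Lemma reflection_splitting a d g : pos a -> pos d -> pos (g - d) -> root g ->
  B a g = - 2^-1 -> pos (refl a d) /\ pos (g + a - refl a d).
Proof.
move=> pa pd pe rg ag.
(* The norm of g - a is 3, so [a] is neither of the two summands. *)
have ne : forall c, c = a -> ~ root (g - c).
  move=> c -> /root_norm; rewrite bformBl !bformBr (root_norm rg) (root_norm pa.1).
  by rewrite (bformC g a) ag; lra.
have ad : a <> d by move=> ad; apply: (ne d) => //; case: pe.
have ae : a <> g - d.
  by move=> ae; apply: (ne (g - d)) => //; rewrite subKr; case: pd.
have sum : B a d + B a (g - d) = - 2^-1 by rewrite -bformDr subrKC.
have dE : refl a d = d - (2 * B a d) *: a by rewrite /reflection bformC.
case: (bform_pos hsl pa pd ad) => h; rewrite dE h.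
- rewrite mulr0 scale0r subr0 addrAC; split=> //; apply: posD => //.
  by rewrite bformC; lra.
- by case: (bform_pos hsl pa pe ae) => h'; lra.
- rewrite mulrN divff ?pnatr_eq0// scaleN1r opprK; split.
    by apply: posD => //; rewrite bformC.
  by rewrite opprD addrACA subrr addr0.
Qed.

(** The conclusion asks for [g - b] rather than - s_g b, because splittings are what survives
    prepending a letter. *)
Lemma sum_palindrome (A : set V) l : A `<=` pos -> (forall b, b \in l -> A b) ->
  let g := \sum_(b <- l) b in pos g ->
  exists t p, [/\ forall b, b \in t -> A b, A p, act (rprod t) p = g
    & forall b, b \in path_roots t -> pos b /\ pos (g - b)].
Proof.
move=> hA; have [k] := ubnP (size l); elim: k l => // k IH l lk lA g pg.
have [c cl cg] : exists2 c, c \in l & 0 < B c g.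
  apply: contrapT => h; have := root_norm pg.1; rewrite {1}/g bform_suml.
  move=> E; have : \sum_(i <- l) B i g <= 0.
    rewrite big_seq; apply: sumr_le0 => c cl; rewrite leNgt; apply/negP => cg.
    by apply: h; exists c.
  by rewrite E ler10.
have pc := hA _ (lA _ cl).
have [cgE|cgn] := EM (c = g).
  by exists [::], c; split=> //; [exact: lA|rewrite big_nil geom_act1].
have {}cg : B c g = 2^-1 by case: (bform_pos hsl pc pg cgn) => h; move: cg; rewrite h; lra.
have gE : g = c + \sum_(b <- rem c l) b by rewrite /g (perm_big _ (perm_to_rem cl)) big_cons.
have g'E : \sum_(b <- rem c l) b = g - c by rewrite gE addrC addKr.
have rl b : b \in rem c l -> A b by move/mem_rem; exact: lA.
(* It is a root because (c, g) = 1/2, and it is nonnegative as a sum of the remaining positive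
   roots. *)
have pg' : pos (\sum_(b <- rem c l) b).
  split; first by rewrite g'E; apply: (root_sub pg.1 pc.1); rewrite bformC.
  rewrite big_seq; apply: (big_ind (@nonneg R W cs)) => [i|u v|b /rl /hA []] //.
    by rewrite mxE.
  exact: nonnegD.
have lk' : (size (rem c l) < k)%N by rewrite size_rem//; case: (l) cl lk.
have [t [p [tA pA tp tg]]] := IH (rem c l) lk' rl pg'.
rewrite g'E in tp tg pg'; exists (c :: t), p; split=> //.
- by move=> b; rewrite inE => /predU1P[->|/tA//]; exact: lA.
- rewrite big_cons geom_actM tp refl_eltP; last by case: pc.
  rewrite /reflection bformBl bformC cg (root_norm pc.1) [2 * _](_ : _ = -1); last by field.
  by rewrite scaleN1r opprK subrK.
move=> b; rewrite inE => /predU1P[->//|/mapP[d dt ->]].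
have [pd pgd] := tg d dt.
rewrite refl_eltP; last by case: pc.
(* The splitting of g - c is reflected in [c], with (c, g - c) = 1/2 - 1 = -1/2. *)
rewrite -[X in X - refl _ _](subrK c); apply: reflection_splitting => //; first by case: pg'.
by rewrite bformBr cg (root_norm pc.1); field.
Qed.

Lemma sums_two_closed (A : set V) : A `<=` pos ->
  two_closed cs [set g | pos g /\ exists2 l, (forall b, b \in l -> A b) & g = \sum_(b <- l) b].
Proof.
move=> hA; split=> [g [] //|a b x y [pa [la laA aE]] [pb [lb lbA bE]] x0 y0 pg].
split=> //; case: (pos_combination hsl pa pb x0 y0 pg) => ->; [by exists la|by exists lb|].
exists (la ++ lb); last by rewrite big_cat aE bE.
by move=> c; rewrite mem_cat => /orP[]; [exact: laA|exact: lbA].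
Qed.

Lemma pbr_preclosure_sub (A : set V) : A `<=` pos ->
  pbr_preclosure cs A `<=` two_closure cs A.
Proof.
move=> hA a [pa [t [tA tE tpath tpal]]] C [closedC AC].
have tpos b : b \in t -> pos b by move/tA/hA.
have asc : ascending 1%g t.
  apply/(ascending_path _ tpos); rewrite ell1.
  by under eq_map do rewrite mul1g.
have [s [ts|[p ts]]] := palindromeP _ _ tpal; rewrite ts in tA tE asc tpos.
  (* An even palindrome has product 1, but s_a sends [a] to - a. *)
  have := refl_eltP pa.1 a; rewrite tE big_cat /= prod_rev_refl; last first.
    by move=> b bs; case: (tpos b); rewrite ?mem_cat ?bs.
  rewrite mulgV geom_act1 reflection_id ?root_norm//; last by case: pa.
  by move/(pos_neq_opp pa pa).
have sr b : b \in s -> root b by move=> bs; case: (tpos b); rewrite ?mem_cat ?bs.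
have rp : root p by case: (tpos p); rewrite ?mem_cat ?mem_head ?orbT.
have [pg gs] := (ascending_palindrome sr rp).1 asc.
set g := act _ _ in pg gs.
have -> : a = g.
  rewrite refl_elt_palindrome// -/g in tE.
  have ag : refl a =1 refl g by move=> v; rewrite -(refl_eltP pa.1) tE (refl_eltP pg.1).
  have [//|aN] := reflection_eq pa.1 pg.1 ag.
  by case: (pos_neq_opp pa pg aN).
apply: palindrome_two_closed => //.
  by move=> b bs; apply/AC/tA; rewrite mem_cat bs.
by apply/AC/tA; rewrite mem_cat mem_head orbT.
Qed.

Lemma two_closure_sub (A : set V) : A `<=` pos ->
  two_closure cs A `<=` pbr_preclosure cs A.
Proof.
move=> hA g clg.
(* The positive roots that are sums of elements of [A] form a 2-closed set containing [A], so [g] is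
   such a sum. *)
have [|pg [l lA gl]] := clg _ (conj (sums_two_closed hA) _).
  move=> a Aa; split; first exact: hA.
  by exists [:: a]; rewrite ?big_seq1// => b; rewrite inE => /eqP ->.
rewrite gl in pg; have [t [p [tA pA tp tg]]] := sum_palindrome hA lA pg.
rewrite -gl in pg tp tg.
have mem b : b \in t ++ p :: rev t -> A b.
  rewrite mem_cat inE mem_rev => /orP[/tA//|/orP[/eqP->//|/tA//]].
have tr b : b \in t -> root b by move/tA/hA => -[].
have rp : root p by case: (hA _ pA).
split=> //; exists (t ++ p :: rev t); split=> //.
- by rewrite refl_elt_palindrome// tp.
- have /ascending_path : forall b, b \in t ++ p :: rev t -> pos b by move=> b /mem/hA.
  move=> /(_ 1%g) [_]; rewrite ell1.
  under eq_map do rewrite mul1g.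
  apply; apply/ascending_palindrome => //; rewrite tp; split=> // b bt.
  have [pb pgb] := tg b bt; split=> //.
  (* As b and g - b are roots with sum the root g, (b, g) = 1/2 and hence - s_g b = g - b. *)
  have bgb : B b (g - b) = - 2^-1.
    by apply: bform_add_root; rewrite ?subrKC//; [case: pb|case: pgb|case: pg].
  have bg : B b g = 2^-1 by move: bgb; rewrite bformBr (root_norm pb.1); lra.
  by rewrite /reflection bg divff ?pnatr_eq0// scale1r opprB.
by rewrite rev_cat rev_cons revK -cats1 -catA.
Qed.

End PalindromicChains.

Theorem theorem1p5 (R : realType) (W : finGroupType) (cs : coxeterSystem W)
    (hsl : simply_laced cs) (A : set 'rV[R]_(rank cs))
    (hA : A `<=` pos_roots R cs) :
  pbr_preclosure cs A = two_closure cs A.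
Proof.
by apply/seteqP; split; [exact: pbr_preclosure_sub|exact: two_closure_sub].
Qed.
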